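(* Let $\{A_n\}_{n\geqslant 1}$ be i.i.d. nonnegative random variables with Laplace–Stieltjes transform $\alpha(s)=\mathbb{E}[e^{-sA_1}]$, and let $\{B_n\}_{n\geqslant 1}$ be i.i.d. exponentially distributed with rate $\mu>0$, independent of $\{A_n\}$. Let $W_1\geqslant 0$ be a random variable (possibly a constant) independent of $\{A_n\},\{B_n\}$ with finite mean, and let $W_{n+1}=\max\{0,\,B_{n+1}-A_n-W_n\}$ for $n\geqslant 1$. Then for every $n\geqslant 2$ and $k\geqslant 1$, $$\operatorname{cov}[W_n,W_{n+k}]=\frac{\mathbb{E}[W_n]}{\mu}\left(\mathbb{P}[W_n=0]+\frac12\right)\left(-\frac{\alpha(\mu)}{2}\right)^{k}.$$ Furthermore, if the conditional distribution of $W_1$ given $W_1>0$ is exponential with rate $\mu$, then the same formula holds also for $n=1$. *)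

(* Defs.v *)
From HB Require Import structures.
From mathcomp Require Import all_boot all_order all_algebra.
From mathcomp Require Import all_classical all_reals all_analysis.
Set Implicit Arguments. Unset Strict Implicit. Unset Printing Implicit Defensive.
Import Order.TTheory GRing.Theory Num.Theory.
Local Open Scope classical_set_scope.
Local Open Scope ring_scope.

Definition mutually_independent {d} {T : measurableType d} {R : realType}
  (P : probability T R) {I : eqType} (X : I -> T -> R) : Prop :=
  forall (s : seq I) (S : I -> set R), uniq s ->
    (forall i, measurable (S i)) ->
    P (\big[setI/setT]_(i <- s) (X i @^-1` S i)) =
    \big[*%E/1%E]_(i <- s) P (X i @^-1` S i).

Definition joint_family {T R : Type} (W1 : T -> R) (A B : nat -> T -> R)
  : option (nat + nat) -> T -> R :=
  fun i => match i with
           | None => W1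
           | Some (inl n) => A n.+1
           | Some (inr n) => B n.+1
           end.

(** wait_aux m = W_{m+1}. *)
Fixpoint wait_aux {R : realType} {T : Type} (W1 : T -> R) (A B : nat -> T -> R)
  (m : nat) : T -> R :=
  match m with
  | 0 => W1
  | m'.+1 => fun t => Num.max 0 (B m'.+2 t - A m'.+1 t - wait_aux W1 A B m' t)
  end.

(** Paper indexing: W n = W_n for n >= 1, with W_1 = W1 and
    W_{n+1} = max{0, B_{n+1} - A_n - W_n}. (W 0 = W 1 is junk.) *)
Definition W {R : realType} {T : Type} (W1 : T -> R) (A B : nat -> T -> R)
  (n : nat) : T -> R := wait_aux W1 A B n.-1.

(* Main.v *)
(** Memorylessness of [B] makes [W_n], [n >= 2], exponential with rate [mu] up
    to an atom at 0: [P (W_n > t) = p * exp (- mu * t)].  For the same reason,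
    if [H = max 0 (B - Y)] with [B] independent of [(U, Y)] and [U, Y >= 0],
    then [E (U H) = E (U exp (- mu Y)) / mu] and
    [E (U exp (- mu H)) = E U - E (U exp (- mu Y)) / 2].  Take [U] to be [W_n]
    or [1], and [Y = A_m + W_m] for [m >= n].  As [A_m] is independent of
    [(U, W_m)], the numbers [D_m = cov (W_n, exp (- mu W_m))] satisfy
    [D_(m+1) = - alpha / 2 * D_m], while
    [cov (W_n, W_(m+1)) = alpha / mu * D_m].  The formula follows from the
    value of [D_n], which only involves the law of [W_n]. *)
Require Import Defs.
From HB Require Import structures.
From mathcomp Require Import all_boot all_order all_algebra.
From mathcomp Require Import all_classical all_reals all_analysis.
From mathcomp Require Import measurable_realfun ring lra.
Import Order.TTheory GRing.Theory Num.Theory.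
Set Implicit Arguments. Unset Strict Implicit. Unset Printing Implicit Defensive.
Local Open Scope classical_set_scope.
Local Open Scope ring_scope.

(** * Integration against a measure given by a density *)

Section density.
Context d (T : measurableType d) (R : realType).
Variables (m nu : {measure set T -> \bar R}) (h : T -> R).
Hypotheses (mh : measurable_fun setT h) (h0 : forall x, 0 <= h x).
Hypothesis nuE :
  forall A, measurable A -> nu A = (\int[m]_(x in A) (h x)%:E)%E.
Local Open Scope ereal_scope.
Import HBNNSimple.

Let mEh : measurable_fun setT (fun x => (h x)%:E).
Proof. exact/measurable_EFinP. Qed.

(** On simple functions the identity reduces, one level set at a time, to [nuE]; monotone
    convergence on both sides gives the general case. *)
Lemma ge0_integral_density (f : T -> \bar R) :
  measurable_fun setT f -> (forall x, 0 <= f x) ->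
  \int[nu]_x f x = \int[m]_x (f x * (h x)%:E).
Proof.
move=> mf f0; pose f_ := nnsfun_approx measurableT mf.
have step n : \int[nu]_x (f_ n x)%:E = \int[m]_x ((f_ n x)%:E * (h x)%:E).
  under [LHS]eq_integral do rewrite fimfunE -fsumEFin//.
  rewrite [LHS]ge0_integral_fsum//; last 2 first.
  - by move=> r; exact/measurable_EFinP/measurableT_comp.
  - by move=> r x _; rewrite EFinM nnfun_muleindic_ge0.
  under [RHS]eq_integral.
    move=> x _; rewrite fimfunE -fsumEFin// ge0_mule_fsuml; last first.
      by move=> r; rewrite EFinM nnfun_muleindic_ge0.
    over.
  rewrite [RHS]ge0_integral_fsum//; last 2 first.
  - move=> r; apply: emeasurable_funM => //.
    exact/measurable_EFinP/measurableT_comp.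
  - move=> r x _; apply: mule_ge0; last by rewrite lee_fin.
    by rewrite EFinM nnfun_muleindic_ge0.
  apply: eq_fsbigr => r /set_mem[t _ frt].
  have r0 : (0 <= r)%R by rewrite -frt.
  have mr : measurable (f_ n @^-1` [set r]) by [].
  under [LHS]eq_integral do rewrite EFinM.
  under [RHS]eq_integral do rewrite EFinM -muleA.
  rewrite !ge0_integralZl//; last 3 first.
  - apply: emeasurable_funM => //; exact/measurable_EFinP/measurable_indic.
  - by move=> x _; rewrite mule_ge0// lee_fin.
  - exact/measurable_EFinP/measurable_indic.
  congr (_ * _); rewrite integral_indic// setIT nuE// integral_mkcond.
  apply: eq_integral => x _; rewrite patchE indicE.
  by case: (x \in _); rewrite ?mul1e ?mul0e.
transitivity (limn (fun n => \int[nu]_x (f_ n x)%:E)).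
  rewrite -monotone_convergence//=.
  - apply: eq_integral => x _; apply/esym/cvg_lim => //=.
    exact: cvg_nnsfun_approx.
  - by move=> n; exact/measurable_EFinP/measurable_funTS.
  - by move=> n x _; rewrite lee_fin.
  - by move=> x _ a b ab; rewrite lee_fin; exact/lefP/nd_nnsfun_approx.
under eq_fun do rewrite step.
rewrite -monotone_convergence//=.
- apply: eq_integral => x _; apply/cvg_lim => //=.
  by apply: cvgeZr => //; exact: cvg_nnsfun_approx.
- move=> n; apply: emeasurable_funM => //.
  exact/measurable_EFinP/measurable_funTS.
- by move=> n x _; rewrite mule_ge0// lee_fin.
- move=> x _ a b ab; rewrite lee_wpmul2r ?lee_fin//.
  exact/lefP/nd_nnsfun_approx.
Qed.
End density.

(** * Tail of the exponential law *)

Section exponential_tail.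
Import numFieldTopology.Exports.

(** The density has the primitive [- expR (- mu * x)], which tends to 0 at infinity. *)
Lemma exponential_prob_itvoy (R : realType) (mu t : R) : 0 < mu -> 0 <= t ->
  exponential_prob mu `]t, +oo[ = (expR (- mu * t))%:E.
Proof.
move=> mu0 t0; rewrite /exponential_prob.
have cexp : continuous (fun z : R^o => expR (- mu * z)).
  move=> z; apply: continuous_comp; last exact: continuous_expR.
  by apply: continuousM => //; exact: cst_continuous.
rewrite integral_itv_obnd_cbnd; last first.
  by apply/measurable_EFinP/measurable_funTS; exact: measurable_exponential_pdf.
rewrite (@ge0_continuous_FTC2y _ _ (fun x => - expR (- mu * x)) _ 0)//.
- by rewrite sub0e -EFinN opprK.
- by move=> x _; apply: exponential_pdf_ge0; exact: ltW.
- apply: (@continuous_subspaceW R^o _ _ [set` `[0, +oo[%R]).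
    by apply: subset_itvr; rewrite bnd_simp.
  exact: within_continuous_exponential_pdf.
- rewrite -oppr0; apply: cvgN.
  rewrite (_ : (fun x => expR (- mu * x)) =
               (fun z => expR (- z)) \o (fun z => mu * z)); last first.
    by apply: eq_fun => x; rewrite mulNr.
  apply: (@cvg_comp _ _ _ _ _ _ (pinfty_nbhs R)); last exact: cvgr_expR.
  exact: gt0_cvgMry.
- by apply: cvgN; apply/cvg_at_right_filter; exact: cexp.
- move=> x; rewrite in_itv/= andbT => tx.
  by apply: derive1_exponential_pdf; rewrite in_itv/= andbT (le_lt_trans t0).
Qed.

End exponential_tail.

(** The canonical probability on [exponential_prob mu] needs [0 < mu], which
    unification cannot find. *)
Definition exponential_probability (R : realType) (mu : R) (mu0 : 0 < mu) :
    probability (measurableTypeR R) R :=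
  @exponential_distribution_exponential_prob__canonical__probability_measure_Probability
    R mu mu0.

(** * Nonnegative variables with an exponential tail and an atom at 0 *)

Section exponential_with_atom.
Context d (T : measurableType d) (R : realType) (P : probability T R).
Variables (X : T -> R) (mu p : R).
Hypotheses (mX : measurable_fun setT X) (X0 : forall x, 0 <= X x).
Hypothesis mu0 : 0 < mu.
Hypothesis tailX :
  forall t, 0 <= t -> P (X @^-1` `]t, +oo[) = (p * expR (- mu * t))%:E.

Let tailX0 : P (X @^-1` `]0, +oo[) = p%:E.
Proof. by rewrite tailX// mulr0 expR0 mulr1. Qed.

Let mpre (V : set R) : measurable V -> measurable (X @^-1` V).
Proof. by move=> mV; rewrite -[_ @^-1` _]setTI; exact: mX. Qed.

Let p_ge0 : 0 <= p.
Proof. by rewrite -lee_fin -tailX0. Qed.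

Let p_le1 : p <= 1.
Proof. by rewrite -lee_fin -tailX0 probability_le1//; exact: mpre. Qed.

Lemma prob_eq0_exponential_tail : P (X @^-1` [set 0]) = (1 - p)%:E.
Proof.
have -> : X @^-1` [set 0] = ~` (X @^-1` `]0, +oo[).
  apply/seteqP; split => x /=; rewrite in_itv/= andbT.
    by move=> ->; rewrite ltxx.
  by move/negP; rewrite -leNgt => Xx; apply/eqP; rewrite eq_le Xx X0.
by rewrite probability_setC ?tailX0//; exact: mpre.
Qed.

(** The mean is the integral of the tail, and the tail is [p / mu] times the exponential density, of
    total mass 1. *)
Lemma expectation_exponential_tail : (\int[P]_x (X x)%:E = (p / mu)%:E)%E.
Proof.
pose X' : {RV P >-> R} := HB.pack X (isMeasurableFun.Build _ _ _ _ X mX).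
transitivity ('E_P[X'])%E; first by rewrite expectation_def.
rewrite ge0_expectation_ccdf//.
transitivity (\int[lebesgue_measure]_(r in `[0%R, +oo[)
   ((p / mu)%:E * (exponential_pdf mu r)%:E))%E.
  apply: eq_integral => r; rewrite inE/= in_itv/= andbT => r0.
  rewrite /ccdf /distribution/= /pushforward tailX//.
  by rewrite exponential_pdfE// -EFinM mulrA divfK ?gt_eqF.
rewrite ge0_integralZl//; last 3 first.
- by apply/measurable_EFinP/measurable_funTS; exact: measurable_exponential_pdf.
- by move=> r _; rewrite lee_fin exponential_pdf_ge0// ltW.
- by rewrite lee_fin divr_ge0// ltW.
rewrite -[RHS]mule1 -(integral_exponential_pdf mu0); congr (_ * _)%E.
rewrite integral_mkcond; apply: eq_integral => r _.
rewrite patchE; case: ifPn => //; rewrite notin_setE/= in_itv/= andbT => /negP.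
by rewrite -ltNge => r0; rewrite lt0_exponential_pdf.
Qed.


Let TR := measurableTypeR R.

Let E : probability TR R := exponential_probability mu0.

(** The rays []x, +oo[] are stable under intersection and generate the Borel sets, so comparing
    tails is enough. For [x >= 0] the Dirac mass gives nothing; for [x < 0] both sides are 1. *)
Lemma law_exponential_tail (V : set TR) : measurable V ->
  (P (X @^-1` V) = (1 - p)%:E * dirac (0%R : TR) V + p%:E * E V)%E.
Proof.
move=> mV.
pose X' : {RV P >-> TR} := HB.pack X (isMeasurableFun.Build _ _ _ TR X mX).
have q0 : 0 <= 1 - p by rewrite subr_ge0.
pose m2 := measure_add (mscale (NngNum q0) (dirac (0%R : TR)))
                       (mscale (NngNum p_ge0) E).
pose m1 : {measure set TR -> \bar R} := distribution P X'.
have m2E A : m2 A = ((1 - p)%:E * dirac (0%R : TR) A + p%:E * E A)%E.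
  by rewrite /m2 measure_addE.
rewrite -m2E.
rewrite -[LHS]/(m1 V).
apply: (@measure_unique _ R TR (@RGenOInfty.G R)
  (fun n => `]- n%:R, +oo[%classic) _ _ _ _ m1 m2) => //.
- exact: RGenOInfty.measurableE.
- move=> _ _ [x ->] [y ->]; exists (Num.max x y).
  apply/seteqP; split => z /=; rewrite !in_itv/= !andbT gt_max.
    by move=> [-> ->].
  by move=> /andP[].
- by move=> n; exists (- n%:R).
- rewrite -subTset => x _ /=; exists (Num.bound x) => //=.
  by rewrite in_itv/= andbT ltrNl unstable.ltrNbound.
- move=> _ [x ->]; rewrite -[RHS]/(m2 _) m2E.
  rewrite -[LHS]/(P (X @^-1` `]x, +oo[)).
  have [x0|x0] := leP 0 x.
    rewrite tailX// diracE memNset/=; last by rewrite in_itv/= andbT ltNge x0.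
    by rewrite mule0 add0e exponential_prob_itvoy// EFinM.
  rewrite diracE mem_set/=; last by rewrite in_itv/= andbT.
  have sub0 : `]0, +oo[%classic `<=` (`]x, +oo[%classic : set R).
    by apply: subset_itvr; rewrite bnd_simp ltW.
  rewrite mule1.
  have -> : exponential_prob mu `]x, +oo[ = 1%E.
    apply/eqP; rewrite eq_le (@probability_le1 _ _ _ E)//=.
    have := exponential_prob_itvoy mu0 (lexx 0).
    rewrite mulr0 expR0 => <-.
    by apply: (@le_measure _ _ _ E); rewrite ?inE.
  rewrite mule1 -EFinD subrK.
  rewrite (_ : _ @^-1` _ = setT) ?probability_setT// -subTset => t _ /=.
  by rewrite in_itv/= andbT (lt_le_trans x0).
- by move=> n; rewrite (le_lt_trans (probability_le1 _ _)) ?ltry//; exact: mpre.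
Qed.

Lemma ge0_integral_exponential_tail (g : R -> R) :
  measurable_fun setT g -> (forall x, 0 <= g x) ->
  (\int[P]_x (g (X x))%:E = ((1 - p) * g 0)%:E +
   p%:E * \int[lebesgue_measure]_x (g x * exponential_pdf mu x)%:E)%E.
Proof.
move=> mg g0.
have mEg : measurable_fun [set: TR] (fun x : TR => (g x)%:E).
  exact/measurable_EFinP.
pose X' : {RV P >-> TR} := HB.pack X (isMeasurableFun.Build _ _ _ TR X mX).
have q0 : 0 <= 1 - p by rewrite subr_ge0.
pose m2 := measure_add (mscale (NngNum q0) (dirac (0%R : TR)))
                       (mscale (NngNum p_ge0) E).
transitivity (\int[distribution P X']_x (g x)%:E)%E.
  by rewrite ge0_integral_distribution// => x; rewrite lee_fin.
transitivity (\int[m2]_x (g x)%:E)%E.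
  apply: eq_measure_integral => A mA _.
  rewrite -[LHS]/(P (X @^-1` A)) law_exponential_tail//.
  by rewrite -[RHS]/(m2 _) /m2 measure_addE.
rewrite ge0_integral_measure_add//; last by move=> x _; rewrite lee_fin.
rewrite !ge0_integral_mscale//; [|by move=> x _; rewrite lee_fin..].
rewrite integral_dirac// diracT mul1e/= -EFinM; congr (_ + _ * _)%E.
under [RHS]eq_integral do rewrite EFinM.
apply: (@ge0_integral_density _ TR R lebesgue_measure E) => //.
- exact: measurable_exponential_pdf.
- by move=> x; apply: exponential_pdf_ge0; exact: ltW.
Qed.

(** Multiplying the density of rate [mu] by [exp (- mu * x)] gives half the
    density of rate [2 * mu]. *)
Lemma laplace_exponential_tail :
  (\int[P]_x (expR (- mu * X x))%:E = (1 - p / 2)%:E)%E.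
Proof.
rewrite (ge0_integral_exponential_tail (g := fun x => expR (- mu * x))).
- have -> : (\int[lebesgue_measure]_x
      (expR (- mu * x) * exponential_pdf mu x)%:E = (2^-1)%:E)%E.
    transitivity (\int[lebesgue_measure]_x
      ((2^-1)%:E * (exponential_pdf (2 * mu) x)%:E))%E.
      apply: eq_integral => x _; rewrite -EFinM; congr EFin.
      have [x0|x0] := ltP x 0; first by rewrite !lt0_exponential_pdf// !mulr0.
      rewrite !exponential_pdfE// mulrCA -expRD !mulrA mulVf// mul1r.
      by congr (_ * expR _); ring.
    rewrite ge0_integralZl//; last 2 first.
    + by apply/measurable_EFinP; exact: measurable_exponential_pdf.
    + by move=> x _; rewrite lee_fin exponential_pdf_ge0// mulr_ge0// ltW.
    by rewrite integral_exponential_pdf ?mule1 ?mulr_gt0.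
  rewrite mulr0 expR0 -EFinM -EFinD; congr EFin; lra.
- by apply: measurableT_comp => //; exact: measurable_funM.
- by move=> x; exact: expR_ge0.
Qed.

End exponential_with_atom.

(** Integration by parts is avoided: under the exponential law itself, [Num.max 0 x] has an
    exponential tail of mass 1, so the mean formula above applies. *)
Lemma mean_exponential_pdf (R : realType) (mu : R) : 0 < mu ->
  (\int[lebesgue_measure]_x (Num.max 0 x * exponential_pdf mu x)%:E =
   (mu^-1)%:E)%E.
Proof.
move=> mu0; pose TR := measurableTypeR R.
pose E : probability TR R := exponential_probability mu0.
have mmax : measurable_fun [set: TR] (fun x : TR => Num.max 0 x : R).
  exact: measurable_maxr.
transitivity (\int[E]_x (Num.max 0 x)%:E)%E.
  under eq_integral do rewrite EFinM.
  apply/esym; apply: (@ge0_integral_density _ TR R lebesgue_measure E) => //.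
  - exact: measurable_exponential_pdf.
  - by move=> x; apply: exponential_pdf_ge0; exact: ltW.
  - exact/measurable_EFinP.
  - by move=> x; rewrite lee_fin le_max lexx.
rewrite (@expectation_exponential_tail _ TR R E _ mu 1) ?mul1r//.
  by move=> x; rewrite le_max lexx.
move=> t t0; rewrite mul1r -(exponential_prob_itvoy mu0 t0); congr (E _).
apply/seteqP; split => x /=; rewrite !in_itv/= !andbT lt_max.
  by rewrite ltNge t0.
by move=> ->; rewrite orbT.
Qed.

(** The integrand vanishes at the atom. Elsewhere [expR (- mu * x)] turns the density into half the
    one of rate [2 * mu], whose mean is [(2 * mu)^-1]; hence the 4. *)
Lemma mean_laplace_exponential_tail d (T : measurableType d) (R : realType)
    (P : probability T R) (X : T -> R) (mu p : R) :
  measurable_fun setT X -> (forall x, 0 <= X x) -> 0 < mu ->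
  (forall t, 0 <= t -> P (X @^-1` `]t, +oo[) = (p * expR (- mu * t))%:E) ->
  (\int[P]_x (X x * expR (- mu * X x))%:E = (p / (4 * mu))%:E)%E.
Proof.
move=> mX X0 mu0 tailX.
transitivity (\int[P]_t ((fun x => Num.max 0 x * expR (- mu * x)) (X t))%:E)%E.
  by apply: eq_integral => t _; rewrite /= max_r.
rewrite (ge0_integral_exponential_tail mX X0 mu0 tailX
  (g := fun x => Num.max 0 x * expR (- mu * x))); last 2 first.
- apply: measurable_funM; first exact: measurable_maxr.
  by apply: measurableT_comp => //; exact: measurable_funM.
- by move=> x; rewrite mulr_ge0 ?expR_ge0// le_max lexx.
have -> : (\int[lebesgue_measure]_x
    (Num.max 0 x * expR (- mu * x) * exponential_pdf mu x)%:E =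
    ((4 * mu)^-1)%:E)%E.
  transitivity (\int[lebesgue_measure]_x
    ((2^-1)%:E * (Num.max 0 x * exponential_pdf (2 * mu) x)%:E))%E.
    apply: eq_integral => x _; rewrite -EFinM; congr EFin.
    have [x0|x0] := ltP x 0; first by rewrite !lt0_exponential_pdf// !mulr0.
    rewrite !exponential_pdfE// (_ : - (2 * mu) * x = - mu * x + - mu * x).
      by rewrite expRD; field.
    by ring.
  rewrite ge0_integralZl//; last 2 first.
  - apply/measurable_EFinP; apply: measurable_funM.
      exact: measurable_maxr.
    exact: measurable_exponential_pdf.
  - move=> x _; rewrite lee_fin mulr_ge0 ?le_max ?lexx// exponential_pdf_ge0//.
    by rewrite mulr_ge0// ltW.
  rewrite mean_exponential_pdf ?mulr_gt0// -EFinM; congr EFin.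
  by field; rewrite gt_eqF.
by rewrite maxxx mul0r mulr0 add0e.
Qed.

(** * Independence of one coordinate from all the others *)

(** [s] is a finite set of coordinates on which the cylinder depends; taking
    [S i = setT] elsewhere makes intersections coordinatewise. *)
Definition other_cylinders {T : Type} {R : realType} {I : eqType}
    (X : I -> T -> R) (i0 : I) : set (set T) :=
  [set F | exists (s : seq I) (S : I -> set R), [/\ i0 \notin s,
    forall i, measurable (S i), forall i, i \notin s -> S i = setT &
    F = [set t | forall i, S i (X i t)]]].

Section independence.
Context d (T : measurableType d) (R : realType) (P : probability T R).
Context (I : choiceType) (X : I -> T -> R).
Hypotheses (mX : forall i, measurable_fun setT (X i)).
Hypothesis indepX : mutually_independent P X.
Variable i0 : I.

Local Notation G := (other_cylinders X i0).

(** The sample space, with the sigma-algebra generated by the [X i], [i != i0]. *)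
Definition others := g_sigma_algebraType G.

HB.instance Definition _ := Measurable.on others.

Let mpre i (V : set R) : measurable V -> measurable (X i @^-1` V).
Proof. by move=> mV; rewrite -[_ @^-1` _]setTI; exact: mX. Qed.

Lemma measurable_fun_others i : i != i0 ->
  measurable_fun setT (X i : others -> R).
Proof.
move=> ii0 _ V mV; rewrite setTI; apply: sub_sigma_algebra.
exists [:: i], (fun j => if j == i then V else setT); split.
- by rewrite mem_seq1 eq_sym.
- by move=> j; case: ifP.
- by move=> j; rewrite mem_seq1 => /negbTE ->.
- apply/seteqP; split => t /=.
    by move=> Vt j; case: eqP => // ->.
  by move=> /(_ i); rewrite eqxx.
Qed.

(** [undup] appears because mutual independence only speaks of duplicate-free lists. *)
Let cylinderE s (S : I -> set R) : (forall i, i \notin s -> S i = setT) ->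
  [set t | forall i, S i (X i t)] =
  \big[setI/setT]_(i <- undup s) (X i @^-1` S i).
Proof.
move=> sS; rewrite -bigcap_seq; apply/seteqP; split => t /=.
  by move=> St i _; exact: St.
move=> St i; have [si|/sS ->//] := boolP (i \in s).
by apply: St; rewrite /= mem_undup.
Qed.

Lemma measurable_other_cylinders : G `<=` measurable.
Proof.
move=> _ [s [S [_ mS sS ->]]]; rewrite (cylinderE sS).
by apply: bigsetI_measurable => i _; exact: mpre.
Qed.

Lemma measurable_others (F : set others) :
  measurable F -> measurable (F : set T).
Proof.
by apply: smallest_sub; [exact: sigma_algebra_measurable|
  exact: measurable_other_cylinders].
Qed.

(** For fixed [S0] both sides are finite measures in [F]. They agree on cylinders, which are stable
    under intersection and generate the sigma-algebra. *)
Lemma independence_others (F : set others) (S0 : set R) :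
  measurable F -> measurable S0 ->
  P (F `&` X i0 @^-1` S0) = (P F * P (X i0 @^-1` S0))%E.
Proof.
move=> mF mS0; have mE := mpre i0 mS0; set E := _ @^-1` S0 in mE *.
have q0 : 0 <= fine (P E) by rewrite fine_ge0.
pose m1 : {measure set T -> \bar R} := mrestr P mE.
pose m2 : {measure set T -> \bar R} := mscale (NngNum q0) P.
suff : m1 F = m2 F.
  rewrite /m1 /m2/= /mrestr /mscale/= => ->.
  by rewrite muleC fineK// fin_num_measure.
apply: (@g_sigma_algebra_measure_unique _ R T G _ (fun=> setT)) => //.
- exact: measurable_other_cylinders.
- by move=> _; exists [::], (fun=> setT); split => //; apply/seteqP; split.
- by rewrite bigcup_const.
- move=> _ _ [s1 [S1 [i1 mS1 sS1 ->]]] [s2 [S2 [i2 mS2 sS2 ->]]].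
  exists (s1 ++ s2), (fun i => S1 i `&` S2 i); split.
  + by rewrite mem_cat negb_or i1.
  + by move=> i; exact: measurableI.
  + move=> i; rewrite mem_cat negb_or => /andP[/sS1 -> /sS2 ->].
    by rewrite setIT.
  + apply/seteqP; split => t /=; first by move=> [? ?] i; split.
    by move=> St; split=> i; have [] := St i.
- move=> _ [s [S [si mS sS ->]]].
  rewrite /m1 /m2/= /mrestr /mscale/= (cylinderE sS) fineK ?fin_num_measure//.
  (* As [i0] is not in [s], the constraint [S0] can be added on that coordinate and independence
     used for [i0 :: undup s]. *)
  pose S' i := if i == i0 then S0 else S i.
  have SS' : forall i, i \in undup s -> X i @^-1` S i = X i @^-1` S' i.
    move=> i; rewrite mem_undup /S'; case: eqP => // -> si0.
    by rewrite si0 in si.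
  have mS' i : measurable (S' i) by rewrite /S'; case: ifP.
  have us : uniq (i0 :: undup s) by rewrite /= mem_undup si undup_uniq.
  have := indepX us mS'; rewrite !big_cons.
  rewrite (eq_big_seq _ SS') setIC (_ : E = X i0 @^-1` S' i0) => [->|]; last first.
    by rewrite /S' eqxx.
  by congr (_ * _)%E; rewrite indepX// undup_uniq.
- by move=> _; rewrite /m1/= (le_lt_trans (probability_le1 _ _)) ?ltry//;
    exact: measurableI.
Qed.

End independence.

(** * Tonelli's theorem for independent variables *)

Section fubini_independent.
Context d d1 d2 (T : measurableType d) (T1 : measurableType d1)
  (T2 : measurableType d2) (R : realType) (P : probability T R).
Variables (Y : T -> T1) (Z : T -> T2).
Hypotheses (mY : measurable_fun setT Y) (mZ : measurable_fun setT Z).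
Hypothesis indepYZ : forall A B, measurable A -> measurable B ->
  P (Y @^-1` A `&` Z @^-1` B) = (P (Y @^-1` A) * P (Z @^-1` B))%E.
Local Open Scope ereal_scope.

(** By independence the joint law of [Y] and [Z] is the product of their laws, to which Tonelli's
    theorem applies. *)
Lemma ge0_integral_independent (f : T1 * T2 -> \bar R) :
  measurable_fun setT f -> (forall x, 0 <= f x) ->
  \int[P]_t f (Y t, Z t) = \int[P]_t \int[P]_u f (Y t, Z u).
Proof.
move=> mf f0.
pose Y' : {RV P >-> T1} := HB.pack Y (isMeasurableFun.Build _ _ _ _ Y mY).
pose Z' : {RV P >-> T2} := HB.pack Z (isMeasurableFun.Build _ _ _ _ Z mZ).
pose YZ t := (Y t, Z t).
have mYZ : measurable_fun setT YZ by exact: measurable_fun_pair.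
pose YZ' : {RV P >-> (T1 * T2)%type} :=
  HB.pack YZ (isMeasurableFun.Build _ _ _ _ YZ mYZ).
transitivity (\int[distribution P YZ']_x f x).
  by rewrite ge0_integral_distribution.
transitivity (\int[distribution P Y' \x distribution P Z']_x f x).
  apply: eq_measure_integral => A mA _.
  by apply/esym/product_measure_unique => // B C mB mC; exact: indepYZ.
rewrite fubini_tonelli1// ge0_integral_distribution//; last 2 first.
- exact: measurable_fun_fubini_tonelli_F.
- by move=> x; apply: integral_ge0.
apply: eq_integral => t _; rewrite /= /fubini_F ge0_integral_distribution//.
exact: measurableT_comp.
Qed.

End fubini_independent.

(** The first variable is the identity, seen as a map into the coarser space [others X i0]; the
    integrand may thus depend on all other coordinates at once. *)
Lemma ge0_integral_others d (T : measurableType d) (R : realType)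
    (P : probability T R) (I : choiceType) (X : I -> T -> R) (i0 : I)
    (f : others X i0 * R -> \bar R) :
  (forall i, measurable_fun setT (X i)) -> mutually_independent P X ->
  measurable_fun setT f -> (forall x, (0 <= f x)%E) ->
  (\int[P]_t f (t, X i0 t) = \int[P]_t \int[P]_u f (t, X i0 u))%E.
Proof.
move=> mX indepX mf f0.
apply: (@ge0_integral_independent _ _ _ T (others X i0) R R P id (X i0)) => //.
- by move=> _ V mV; rewrite setTI; exact: (measurable_others mX mV).
- by move=> A B mA mB; exact: independence_others.
Qed.

Lemma measurable_fun_of_others d (T : measurableType d) (R : realType)
    (I : choiceType) (X : I -> T -> R) (i0 : I) (f : others X i0 -> R) :
  (forall i, measurable_fun setT (X i)) -> measurable_fun setT f ->
  measurable_fun setT (f : T -> R).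
Proof.
move=> mX mf _ V mV; apply: measurableI => //; apply: (measurable_others mX).
by rewrite -[_ @^-1` _]setTI; exact: mf.
Qed.

(** * Integrating out one independent coordinate *)

Section independent_coordinate.
Context d (T : measurableType d) (R : realType) (P : probability T R).
Context (I : choiceType) (X : I -> T -> R) (i0 : I).
Hypotheses (mX : forall i, measurable_fun setT (X i)).
Hypothesis indepX : mutually_independent P X.
Variables (U : others X i0 -> R).
Hypotheses (mU : measurable_fun setT U) (U0 : forall t, 0 <= U t).

Lemma ge0_integralM_others (g : R -> R) :
  measurable_fun setT g -> (forall x, 0 <= g x) ->
  (\int[P]_t (U t * g (X i0 t))%:E =
   \int[P]_t (U t)%:E * \int[P]_t (g (X i0 t))%:E)%E.
Proof.
move=> mg g0.
rewrite (@ge0_integral_others _ _ _ _ _ _ i0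
  (fun z => (U z.1 * g z.2)%:E) mX indepX)/=; last 2 first.
- apply/measurable_EFinP; apply: measurable_funM.
    exact: measurableT_comp mU measurable_fst.
  exact: measurableT_comp mg measurable_snd.
- by move=> z; rewrite lee_fin mulr_ge0.
have mgX : measurable_fun setT (fun u => (g (X i0 u))%:E).
  by apply/measurable_EFinP; exact: measurableT_comp mg (mX i0).
rewrite -ge0_integralZr//; last 3 first.
- by apply/measurable_EFinP; exact: measurable_fun_of_others mX mU.
- by move=> t _; rewrite lee_fin.
- by apply: integral_ge0 => t _; rewrite lee_fin.
apply: eq_integral => t _; under eq_integral do rewrite EFinM.
by rewrite ge0_integralZl// ?lee_fin// => u _; rewrite lee_fin.
Qed.

Variables (mu : R) (Y : others X i0 -> R).
Hypotheses (mu0 : 0 < mu).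
Hypotheses (mY : measurable_fun setT Y) (Y0 : forall t, 0 <= Y t).
Hypothesis tailX :
  forall t, 0 <= t -> P (X i0 @^-1` `]t, +oo[) = (expR (- mu * t))%:E.

Let H t := Num.max 0 (X i0 t - Y t).

(** Once the other coordinates are frozen, [U] and [Y] are constants, and the integral over [X i0]
    alone is given by [c]. *)
Lemma ge0_integral_reflected (g c : R -> R) :
  measurable_fun setT g -> (forall x, 0 <= g x) ->
  (forall y, 0 <= y ->
    (\int[P]_u (g (Num.max 0 (X i0 u - y)%R))%:E = (c y)%:E)%E) ->
  (\int[P]_t (U t * g (H t))%:E = \int[P]_t (U t * c (Y t))%:E)%E.
Proof.
move=> mg g0 gc.
rewrite (@ge0_integral_others _ _ _ _ _ _ i0
  (fun z => (U z.1 * g (Num.max 0 (z.2 - Y z.1)))%:E) mX indepX)/=; last 2 first.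
- apply/measurable_EFinP; apply: measurable_funM.
    exact: measurableT_comp mU measurable_fst.
  apply: measurableT_comp => //; apply: measurable_maxr => //.
  apply: measurable_funB; first exact: measurable_snd.
  exact: measurableT_comp mY measurable_fst.
- by move=> z; rewrite lee_fin mulr_ge0.
apply: eq_integral => t _; under eq_integral do rewrite EFinM.
rewrite ge0_integralZl//; last 3 first.
- apply/measurable_EFinP; apply: measurableT_comp => //.
  by apply: measurable_maxr => //; exact: measurable_funB.
- by move=> u _; rewrite lee_fin.
- by rewrite lee_fin.
by rewrite gc// EFinM.
Qed.

(** Memorylessness: the truncated variable exceeds [t] exactly when [X i0] exceeds [y + t]. *)
Let tail_max y t : 0 <= y -> 0 <= t ->
  P ((fun u => Num.max 0 (X i0 u - y)) @^-1` `]t, +oo[) =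
  (expR (- mu * y) * expR (- mu * t))%:E.
Proof.
move=> y0 t0; rewrite -expRD -mulrDr -tailX ?addr_ge0//; congr (P _).
apply/seteqP; split => u /=; rewrite !in_itv/= !andbT lt_max ltNge t0/=.
  by rewrite ltrBrDr addrC.
by rewrite ltrBrDr addrC.
Qed.

Let mmax y : measurable_fun setT (fun u => Num.max 0 (X i0 u - y)).
Proof. by apply: measurable_maxr => //; exact: measurable_funB. Qed.

Let max0 y u : 0 <= Num.max 0 (X i0 u - y).
Proof. by rewrite le_max lexx. Qed.

Lemma mean_reflected :
  (\int[P]_t (U t * H t)%:E = \int[P]_t (U t * (expR (- mu * Y t) / mu))%:E)%E.
Proof.
(* [ge0_integral_reflected] asks for a function that is nonnegative on the whole line, so
   [Num.max 0] replaces the identity. *)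
transitivity (\int[P]_t (U t * Num.max 0 (H t))%:E)%E.
  by apply: eq_integral => t _; rewrite (max_r (_ : 0 <= H t)) ?max0.
refine (ge0_integral_reflected (g := fun x => Num.max 0 x)
  (c := fun y => expR (- mu * y) / mu) _ _ _).
- exact: measurable_maxr.
- by move=> x; rewrite le_max lexx.
- move=> y y0.
  rewrite -(expectation_exponential_tail (mmax y) (max0 y) mu0
    (fun t => @tail_max y t y0)).
  by apply: eq_integral => t _; rewrite (max_r (max0 y t)).
Qed.

(** A sum rather than a difference, since [U] may have infinite mean here. For fixed [y] the Laplace
    value is [1 - p / 2] with [p = expR (- mu * y)]. *)
Lemma laplace_reflected :
  (\int[P]_t (U t * expR (- mu * H t))%:E +
   \int[P]_t (U t * (expR (- mu * Y t) / 2))%:E = \int[P]_t (U t)%:E)%E.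
Proof.
rewrite (ge0_integral_reflected (g := fun x => expR (- mu * x))
  (c := fun y => 1 - expR (- mu * y) / 2)).
- have e1 t : expR (- mu * Y t) <= 1.
    by rewrite -expR0 ler_expR mulNr oppr_le0 mulr_ge0// ltW.
  have mE : measurable_fun setT (fun t : T => expR (- mu * Y t) / 2).
    apply: measurable_funM => //; apply: measurableT_comp => //.
    by apply: measurable_funM => //; exact: measurable_fun_of_others mX mY.
  have mU' := measurable_fun_of_others mX mU.
  rewrite -ge0_integralD//.
  + apply: eq_integral => t _; rewrite -EFinD; congr EFin; ring.
  + move=> t _; rewrite lee_fin mulr_ge0// subr_ge0.
    by have := e1 t; have := expR_gt0 (- mu * Y t); lra.
  + apply/measurable_EFinP; apply: measurable_funM; first exact: mU'.
    by apply: measurable_funB; [exact: measurable_cst|exact: mE].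
  + by move=> t _; rewrite lee_fin mulr_ge0// divr_ge0// expR_ge0.
  + by apply/measurable_EFinP; apply: measurable_funM.
- by apply: measurableT_comp => //; exact: measurable_funM.
- by move=> x; exact: expR_ge0.
- move=> y y0; exact: (laplace_exponential_tail (mmax y) (max0 y) mu0
    (fun t => @tail_max y t y0)).
Qed.

End independent_coordinate.

(** This is [ge0_integral_reflected] with [U = 1] and [g] the indicator of []t, +oo[]. *)
Lemma tail_reflected d (T : measurableType d) (R : realType)
    (P : probability T R) (I : choiceType) (X : I -> T -> R) (i0 : I) (mu : R)
    (Y : others X i0 -> R) :
  (forall i, measurable_fun setT (X i)) -> mutually_independent P X ->
  measurable_fun setT Y -> (forall t, 0 <= Y t) ->
  (forall t, 0 <= t -> P (X i0 @^-1` `]t, +oo[) = (expR (- mu * t))%:E) ->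
  forall t, 0 <= t ->
  P ((fun u => Num.max 0 (X i0 u - Y u)) @^-1` `]t, +oo[) =
  ((\int[P]_u (expR (- mu * Y u))%:E) * (expR (- mu * t))%:E)%E.
Proof.
move=> mX indepX mY Y0 tailX t t0.
have mH : measurable_fun setT (fun u => Num.max 0 (X i0 u - Y u)).
  apply: measurable_maxr => //; apply: measurable_funB => //.
  exact: measurable_fun_of_others mX mY.
have mt : measurable_fun setT (\1_`]t, +oo[ : R -> R).
  exact: measurable_indic.
set V := (_ @^-1` _).
have mV : measurable V by rewrite -[V]setTI; exact: mH.
transitivity (\int[P]_u (1 * \1_(`]t, +oo[ : set R)
    (Num.max 0 (X i0 u - Y u)%R))%:E)%E.
  rewrite -[V]setIT -integral_indic//; apply: eq_integral => u _.
  by rewrite mul1r !indicE; congr ((nat_of_bool _)%:R%:E);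
    apply/idP/idP; rewrite !inE.
rewrite (@ge0_integral_reflected _ _ _ _ _ _ i0 mX indepX (cst 1)
  (measurable_cst _) (fun=> ler01) Y mY Y0 (\1_`]t, +oo[)
  (fun y => expR (- mu * y) * expR (- mu * t)) mt)//; last first.
  move=> y y0; rewrite -expRD -mulrDr -tailX ?addr_ge0//.
  rewrite -[X in P X]setIT -integral_indic//; last first.
    by rewrite -[_ @^-1` _]setTI; exact: mX.
  apply: eq_integral => u _; rewrite !indicE; congr ((nat_of_bool _)%:R%:E).
  apply/idP/idP; rewrite !inE/= !in_itv/= !andbT lt_max ltNge t0/=;
    by rewrite ltrBrDr addrC.
rewrite -ge0_integralZr//.
- by apply: eq_integral => u _; rewrite mul1r EFinM.
- apply/measurable_EFinP; apply: measurableT_comp => //.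
  by apply: measurable_funM => //; exact: measurable_fun_of_others mX mY.
Qed.

(** * Waiting times and their one-step recursions *)

Section waiting_times.
Context d (T : measurableType d) (R : realType) (P : probability T R).
Variables (A B : nat -> T -> R) (W1 : T -> R) (mu : R).
Hypotheses (mu0 : 0 < mu).
Hypotheses (mA : forall n, measurable_fun setT (A n.+1)).
Hypotheses (mB : forall n, measurable_fun setT (B n.+1)).
Hypotheses (mW1 : measurable_fun setT W1).
Hypotheses (A0 : forall n x, 0 <= A n.+1 x).
Hypothesis distA : forall n (V : set R), measurable V ->
  P (A n.+1 @^-1` V) = P (A 1 @^-1` V).
Hypothesis distB : forall n (V : set R), measurable V ->
  P (B n.+1 @^-1` V) = exponential_prob mu V.
Hypothesis W10 : forall x, 0 <= W1 x.

Local Notation J := (joint_family W1 A B).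
Local Notation V := (wait_aux W1 A B).

Hypothesis indepJ : mutually_independent P J.

Let mJ i : measurable_fun setT (J i).
Proof. by case: i => [[n|n]|] /=. Qed.

Lemma wait_ge0 m t : 0 <= V m t.
Proof. by case: m => [|m] //=; rewrite le_max lexx. Qed.

(** [V m] is built from [W1], from [A_1, ..., A_m] (indices [inl j], [j < m]) and from
    [B_2, ..., B_(m+1)] (indices [inr j], [0 < j <= m]). *)
Lemma measurable_wait_others i0 m :
  i0 != None -> (forall j, (j < m)%N -> i0 != Some (inl j)) ->
  (forall j, (0 < j <= m)%N -> i0 != Some (inr j)) ->
  measurable_fun setT (V m : others J i0 -> R).
Proof.
move=> i0N; elim: m => [|m IH] i0l i0r.
  by apply: (@measurable_fun_others _ _ _ _ J i0 None); rewrite eq_sym.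
apply: measurable_maxr => //; apply: measurable_funB;
  first apply: measurable_funB.
- by apply: (@measurable_fun_others _ _ _ _ J i0 (Some (inr m.+1)));
    rewrite eq_sym i0r/=.
- by apply: (@measurable_fun_others _ _ _ _ J i0 (Some (inl m)));
    rewrite eq_sym i0l.
- apply: IH => j jm; first by rewrite i0l// ltnW.
  by rewrite i0r//; case/andP: jm => -> /leqW.
Qed.

Lemma measurable_wait m : measurable_fun setT (V m).
Proof.
elim: m => [|m IH] //=; apply: measurable_maxr => //.
by apply: measurable_funB => //; exact: measurable_funB.
Qed.

Let al := fine (\int[P]_t (expR (- mu * A 1%N t))%:E)%E.

Let mexp d' (T' : measurableType d') (U : T' -> R) : measurable_fun setT U ->
  measurable_fun setT (fun t => expR (- mu * U t)).
Proof.
by move=> mU; apply: measurableT_comp => //; exact: measurable_funM.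
Qed.

Let exp_le1 (U : T -> R) t : (forall t, 0 <= U t) -> expR (- mu * U t) <= 1.
Proof. by move=> U0; rewrite -expR0 ler_expR mulNr oppr_le0 mulr_ge0// ltW. Qed.

(** The exponential factor is at most 1, so the mean of [U] dominates. *)
Let laplace_fin (U Z : T -> R) : measurable_fun setT U ->
  measurable_fun setT Z -> (forall t, 0 <= U t) -> (forall t, 0 <= Z t) ->
  P.-integrable setT (EFin \o U) ->
  (\int[P]_t (U t * expR (- mu * Z t))%:E)%E \is a fin_num.
Proof.
move=> mU mZ U0 Z0 iU; rewrite ge0_fin_numE; last first.
  by apply: integral_ge0 => t _; rewrite lee_fin mulr_ge0 ?expR_ge0.
have /integrableP[_] := iU; apply: le_lt_trans.
apply: ge0_le_integral => //.
- by move=> t _; rewrite lee_fin mulr_ge0 ?expR_ge0.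
- by apply/measurable_EFinP; apply: measurable_funM => //; exact: mexp.
- by apply: measurableT_comp => //; exact/measurable_EFinP.
- by move=> t _; rewrite /= lee_fin ger0_norm// ler_piMr// exp_le1.
Qed.

Let alE n : (\int[P]_t (expR (- mu * A n.+1 t))%:E = al%:E)%E.
Proof.
have fin1 : (\int[P]_t (expR (- mu * A 1%N t))%:E)%E \is a fin_num.
  under eq_integral do rewrite -[expR _]mul1r.
  apply: (@laplace_fin (cst 1)) => //.
  exact: finite_measure_integrable_cst.
rewrite /al fineK//.
pose TR := measurableTypeR R.
have mg : measurable_fun [set: TR] (fun x : TR => (expR (- mu * x))%:E).
  by apply/measurable_EFinP; exact: mexp (@measurable_id _ _ setT).
have distE k : (\int[P]_t (expR (- mu * A k.+1 t))%:E =
    \int[distribution P (HB.pack_for {RV P >-> TR} (A k.+1)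
      (isMeasurableFun.Build _ _ _ TR _ (mA k)))]_x (expR (- mu * x))%:E)%E.
  by rewrite ge0_integral_distribution// => x; rewrite lee_fin expR_ge0.
rewrite !distE; apply: eq_measure_integral => D mD _; exact: distA.
Qed.

Let tailB n t : 0 <= t -> P (B n.+1 @^-1` `]t, +oo[) = (expR (- mu * t))%:E.
Proof. by move=> t0; rewrite distB// exponential_prob_itvoy. Qed.

Lemma measurable_wait_others_inl m k : (k <= m)%N ->
  measurable_fun setT (V k : others J (Some (inl m)) -> R).
Proof.
move=> km; apply: measurable_wait_others => // j jk.
by apply/eqP => -[mj]; move: jk; rewrite -mj ltnNge km.
Qed.

Lemma measurable_wait_others_inr m k : (k <= m)%N ->
  measurable_fun setT (V k : others J (Some (inr m.+1)) -> R).
Proof.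
move=> km; apply: measurable_wait_others => // j /andP[_ jk].
by apply/eqP => -[mj]; move: jk; rewrite -mj ltnNge km.
Qed.

Section step.
Variable m : nat.

(** [ia] and [ib] index [A_(m+1)] and [B_(m+2)], the fresh variables entering [V m.+1]. *)
Let ia : option (nat + nat) := Some (inl m).
Let ib : option (nat + nat) := Some (inr m.+1).

Let mYb : measurable_fun setT ((fun t => A m.+1 t + V m t) : others J ib -> R).
Proof.
apply: measurable_funD; last exact: measurable_wait_others_inr.
exact: (@measurable_fun_others _ _ _ _ J ib ia).
Qed.

Let Y0 t : 0 <= A m.+1 t + V m t.
Proof. by rewrite addr_ge0// wait_ge0. Qed.

Let waitS : V m.+1 = fun t => Num.max 0 (J ib t - (A m.+1 t + V m t)).
Proof. by apply/funext => t /=; rewrite opprD addrA. Qed.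

(** [A m.+1] is independent of [U] and [V m], so its factor splits off as [al]. The constant [c]
    will be [mu^-1], [2^-1] or [1]. *)
Let shift_laplace (U : T -> R) (c : R) :
  measurable_fun setT (U : others J ia -> R) -> (forall t, 0 <= U t) ->
  0 <= c ->
  (\int[P]_t (U t * (expR (- mu * (A m.+1 t + V m t)) * c))%:E =
   (c * al)%:E * \int[P]_t (U t * expR (- mu * V m t))%:E)%E.
Proof.
move=> mU U0 c0.
have mUV : measurable_fun setT
    ((fun t => U t * expR (- mu * V m t)) : others J ia -> R).
  apply: measurable_funM => //; apply: measurableT_comp => //.
  by apply: measurable_funM => //; exact: measurable_wait_others_inl.
have UV0 t : 0 <= U t * expR (- mu * V m t) by rewrite mulr_ge0 ?expR_ge0.
transitivity (\int[P]_t (c%:E *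
    (U t * expR (- mu * V m t) * expR (- mu * J ia t))%:E))%E.
  apply: eq_integral => t _; rewrite -EFinM mulrDr expRD; congr EFin.
  by rewrite /=; ring.
have mg : measurable_fun setT (fun x : R => expR (- mu * x)).
  by apply: measurableT_comp => //; exact: measurable_funM.
rewrite ge0_integralZl//; last 2 first.
- apply/measurable_EFinP; apply: measurable_funM; last exact: mexp.
  exact: measurable_fun_of_others mJ mUV.
- by move=> t _; rewrite lee_fin mulr_ge0 ?expR_ge0.
rewrite (ge0_integralM_others mJ indepJ mUV UV0 mg) => [|x]; last first.
  exact: expR_ge0.
rewrite [in LHS]alE [(c * al)%:E]EFinM -muleA; congr (_ * _)%E.
exact: muleC.
Qed.

(** [B m.+2] is integrated out first, by memorylessness, then [A m.+1]; hence the two measurability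
    conditions on [U]. *)
Lemma mean_wait_step (U : T -> R) :
  measurable_fun setT (U : others J ia -> R) ->
  measurable_fun setT (U : others J ib -> R) -> (forall t, 0 <= U t) ->
  (\int[P]_t (U t * V m.+1 t)%:E =
   (al / mu)%:E * \int[P]_t (U t * expR (- mu * V m t))%:E)%E.
Proof.
move=> mUa mUb U0.
rewrite [al / mu]mulrC -shift_laplace ?invr_ge0 ?(ltW mu0)//.
under eq_integral do rewrite waitS.
exact: (mean_reflected mJ indepJ mUb U0 mu0 mYb Y0 (tailB m.+1)).
Qed.

Lemma laplace_wait_step (U : T -> R) :
  measurable_fun setT (U : others J ia -> R) ->
  measurable_fun setT (U : others J ib -> R) -> (forall t, 0 <= U t) ->
  (\int[P]_t (U t * expR (- mu * V m.+1 t))%:E +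
   (al / 2)%:E * \int[P]_t (U t * expR (- mu * V m t))%:E =
   \int[P]_t (U t)%:E)%E.
Proof.
move=> mUa mUb U0.
rewrite [al / 2]mulrC -shift_laplace ?invr_ge0//.
under eq_integral do rewrite waitS.
exact: (laplace_reflected mJ indepJ mUb U0 mu0 mYb Y0 (tailB m.+1)).
Qed.

(** Whatever the law of [V m], memorylessness gives the mass [p = E (exp (- mu * (A_(m+1) + V m)))],
    which factors by independence. *)
Lemma tail_wait : exists p, forall t, 0 <= t ->
  P (V m.+1 @^-1` `]t, +oo[) = (p * expR (- mu * t))%:E.
Proof.
have e0 := @laplace_fin (cst 1) (V m) (measurable_cst _) (measurable_wait m)
  (fun=> ler01) (@wait_ge0 m) (finite_measure_integrable_cst _ _ measurableT).
exists (al * fine (\int[P]_t (1 * expR (- mu * V m t))%:E)%E) => t t0.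
rewrite waitS (tail_reflected mJ indepJ mYb Y0 (tailB m.+1) t0).
have := @shift_laplace (cst 1) 1 (measurable_cst _) (fun=> ler01) ler01.
under eq_integral do rewrite /= mul1r mulr1.
rewrite mul1r => ->; rewrite !EFinM; congr (_ * _ * _)%E.
exact/esym/fineK.
Qed.

End step.


(** * Covariance of two waiting times *)

Section covariance_formula.
Variables (N : nat) (p : R).
Hypothesis tailN : forall t, 0 <= t ->
  P (V N @^-1` `]t, +oo[) = (p * expR (- mu * t))%:E.

Let meanN : (\int[P]_t (V N t)%:E = (p / mu)%:E)%E.
Proof.
exact: (expectation_exponential_tail (measurable_wait N) (wait_ge0 N) mu0
  tailN).
Qed.

Let ge0_integrable (U : T -> R) : measurable_fun setT U ->
  (forall t, 0 <= U t) ->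
  (\int[P]_t (U t)%:E)%E \is a fin_num -> P.-integrable setT (EFin \o U).
Proof.
move=> mU U0 fU; apply/integrableP; split; first exact/measurable_EFinP.
under eq_integral do rewrite /= ger0_norm//.
by rewrite -ge0_fin_numE// integral_ge0// => t _; rewrite lee_fin.
Qed.

Let intN : P.-integrable setT (EFin \o V N).
Proof.
by apply: ge0_integrable; rewrite ?meanN//; [exact: measurable_wait|
  exact: wait_ge0].
Qed.

(** [D m] is a mixed moment, not yet a covariance: as [V N] has mean [p / mu], the covariance with
    [expR (- mu * V m)] is [D m - p / mu * L m]. The factor 1 in [L] matches the case [U = 1] of the
    step lemmas. *)
Let D m := fine (\int[P]_t (V N t * expR (- mu * V m t))%:E)%E.
Let L m := fine (\int[P]_t (1 * expR (- mu * V m t))%:E)%E.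

Let DE m : (\int[P]_t (V N t * expR (- mu * V m t))%:E = (D m)%:E)%E.
Proof.
by rewrite /D fineK// laplace_fin//; [exact: measurable_wait|
  exact: measurable_wait|exact: wait_ge0|exact: wait_ge0].
Qed.

Let LE m : (\int[P]_t (1 * expR (- mu * V m t))%:E = (L m)%:E)%E.
Proof.
rewrite /L fineK// (@laplace_fin (cst 1))//; first exact: measurable_wait.
  exact: wait_ge0.
exact: finite_measure_integrable_cst.
Qed.

(** The constant terms [p / mu] and [1] of the recursions for [D] and [L] cancel in this
    combination, leaving a factor [- al / 2] per step. The initial value comes from the law of
    [V N]. *)
Let cov_laplace m : (N <= m)%N ->
  D m - p / mu * L m =
  (- al / 2) ^+ (m - N) * (p / (4 * mu) - p / mu * (1 - p / 2)).
Proof.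
move=> /subnKC <-; rewrite addKn; elim: (m - N)%N => [|k IH].
  rewrite addn0 expr0 mul1r; congr (_ - _ * _).
    rewrite /D (mean_laplace_exponential_tail (measurable_wait N)
      (wait_ge0 N) mu0 tailN)//.
  rewrite /L; under eq_integral do rewrite mul1r.
  by rewrite (laplace_exponential_tail (measurable_wait N)
    (wait_ge0 N) mu0 tailN).
rewrite addnS exprS -(mulrA (- al / 2)) -IH.
have := laplace_wait_step (measurable_wait_others_inl (leq_addr k N))
  (measurable_wait_others_inr (leq_addr k N)) (wait_ge0 N).
have := @laplace_wait_step (N + k)%N (cst 1) (measurable_cst _)
  (measurable_cst _) (fun=> ler01).
rewrite !DE meanN (LE (N + k)) (LE (N + k).+1).
have := expectation_cst P 1; rewrite unlock => ->; rewrite -!EFinM -!EFinD.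
move=> -[e1] [e2].
have -> : D (N + k).+1 = p / mu - al / 2 * D (N + k) by apply: (canRL (addrK _)).
have -> : L (N + k).+1 = 1 - al / 2 * L (N + k) by apply: (canRL (addrK _)).
by ring.
Qed.

(** [mean_wait_step] with [U = V N] and [U = 1] reduces the covariance to [cov_laplace] at index
    [N + k], one step before the second waiting time. *)
Lemma covariance_wait k :
  covariance P (V N) (V (N + k.+1)) =
  ((fine ('E_P[V N])%E / mu) * (fine (P (V N @^-1` [set 0])) + 2^-1)
     * (- al / 2) ^+ k.+1)%:E.
Proof.
have mean1 : (\int[P]_t (V (N + k).+1 t)%:E = (al / mu * L (N + k))%:E)%E.
  rewrite EFinM -LE -(@mean_wait_step (N + k)%N (cst 1) (measurable_cst _)
    (measurable_cst _) (fun=> ler01)).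
  by apply: eq_integral => t _; rewrite mul1r.
have mean2 : (\int[P]_t (V N t * V (N + k).+1 t)%:E =
    (al / mu * D (N + k))%:E)%E.
  rewrite EFinM -DE; apply: mean_wait_step.
  - by apply: measurable_wait_others_inl; exact: leq_addr.
  - by apply: measurable_wait_others_inr; exact: leq_addr.
  - exact: wait_ge0.
rewrite addnS covarianceE; last 3 first.
- exact/Lfun1_integrable.
- apply/Lfun1_integrable/ge0_integrable; rewrite ?mean1//.
    exact: measurable_wait.
  exact: wait_ge0.
- apply/Lfun1_integrable/ge0_integrable; rewrite ?mean2//.
    by apply: measurable_funM; exact: measurable_wait.
  by move=> t; rewrite mulr_ge0//; exact: wait_ge0.
rewrite unlock meanN mean1 [X in (X - _)%E]mean2.
rewrite (prob_eq0_exponential_tail (measurable_wait N) (wait_ge0 N) tailN).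
rewrite -!EFinM -EFinD /= exprS; congr EFin.
have := cov_laplace (leq_addr k N); rewrite addKn => e.
transitivity (al / mu * (D (N + k) - p / mu * L (N + k))); first by ring.
(* The initial value equals [- (p / mu) * (1 - p + 2^-1) / 2]; its factor [- 1 / 2] and the [al] of
   the last step supply the missing power of [- al / 2]. *)
by rewrite e; field; rewrite gt_eqF.
Qed.

End covariance_formula.

End waiting_times.

Theorem theorem3p4 (d : measure_display) (T : measurableType d) (R : realType)
  (P : probability T R) (A B : nat -> T -> R) (W1 : T -> R) (mu : R) :
  0 < mu ->
  (* measurability *)
  (forall n, measurable_fun setT (A n.+1)) ->
  (forall n, measurable_fun setT (B n.+1)) ->
  measurable_fun setT W1 ->
  (* A_n nonnegative and identically distributed *)
  (forall n x, 0 <= A n.+1 x) ->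
  (forall n (V : set R), measurable V ->
     P (A n.+1 @^-1` V) = P (A 1 @^-1` V)) ->
  (* B_n exponential with rate mu *)
  (forall n (V : set R), measurable V ->
     P (B n.+1 @^-1` V) = exponential_prob mu V) ->
  (* W_1 nonnegative with finite mean *)
  (forall x, 0 <= W1 x) ->
  P.-integrable setT (fun x => (W1 x)%:E) ->
  (* W_1, (A_n), (B_n) mutually independent *)
  mutually_independent P (joint_family W1 A B) ->
  let alpha := fine ('E_P[fun x => expR (- mu * A 1%N x)])%E in
  let formula n k :=
    covariance P (W W1 A B n) (W W1 A B (n + k)%N) =
    ((fine ('E_P[W W1 A B n])%E / mu)
       * (fine (P (W W1 A B n @^-1` [set 0])) + 2^-1)
       * (- alpha / 2) ^+ k)%:E in
  (forall n k, (2 <= n)%N -> (1 <= k)%N -> formula n k) /\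
  ((forall t : R, 0 <= t ->
      P (W1 @^-1` [set x | (t < x)%R]) =
      (P (W1 @^-1` [set x | (0 < x)%R]) * (expR (- mu * t))%:E)%E) ->
   forall k, (1 <= k)%N -> formula 1%N k).
Proof.
move=> mu0 mA mB mW1 A0 distA distB W10 _ indepJ alpha formula.
(* [W] at [N.+1] is [wait_aux] at [N]; an exponential tail of some mass [p] suffices for the
   formula. *)
have covE N p k :
    (forall t, 0 <= t -> P (wait_aux W1 A B N @^-1` `]t, +oo[) =
      (p * expR (- mu * t))%:E) -> formula N.+1 k.+1.
  move=> tailN; rewrite /formula /W addSn/= (_ : alpha =
    fine (\int[P]_t (expR (- mu * A 1%N t))%:E)%E); last first.
    by rewrite /alpha unlock.
  exact: (covariance_wait mu0 mA mB mW1 A0 distA distB W10 indepJ tailN).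
split=> [[|[|m]] [|k] // _ _|tail1 [|k] // _].
- have [p tailp] := tail_wait mu0 mA mB mW1 A0 distA distB W10 indepJ m.
  exact: (covE m.+1 p k tailp).
(* For [n = 1] the mass is [P (W1 > 0)], and the assumption on the conditional law is the required
   tail. *)
- apply: (covE 0%N (fine (P (W1 @^-1` [set x | 0 < x])))) => t t0.
  rewrite set_itvoy /= tail1// EFinM fineK// fin_num_measure//.
  rewrite -[_ @^-1` _]setTI; apply: mW1 => //.
  by rewrite -set_itvoy.
Qed.
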